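(* For $\tau\ge0$ let $\mu_\tau$ be the compactly supported probability measure on $[0,1]$ with $S$-transform $S_{\mu_\tau}(z)=\exp\left(\frac{\tau}{1+z}\right)$, and define the charge-transfer cumulants per channel $\kappa_r(\tau)$, $r\ge1$, by $$\int_0^1\log\left(1+(e^{y}-1)t\right)d\mu_\tau(t)=\sum_{r\ge1}\kappa_r(\tau)\frac{y^r}{r!}$$ for $y$ near $0$. Then $$\kappa_1(\tau)=e^{-\tau},\qquad \kappa_2(\tau)=\left(e^{\tau}-1-\tau\right)e^{-2\tau},$$ $$\kappa_3(\tau)=\left(e^{2\tau}-3(1+\tau)e^{\tau}+2+4\tau+3\tau^2\right)e^{-3\tau}.$$
   Context: The $S$-transform of a compactly supported probability measure $\mu\neq\delta_0$ on $[0,\infty)$ is defined near $0$ by $S_\mu(w)=\frac{1+w}{w}\psi_\mu^{-1}(w)$, where $\psi_\mu(z)=\sum_{p\ge1}z^p\int x^p\,d\mu(x)$ and $\psi_\mu^{-1}$ is the compositional inverse near $0$. For every $\tau\ge0$ there is exactly one compactly supported probability measure $\mu_\tau$ on $[0,1]$ with the stated $S$-transform (with $\mu_0=\delta_1$); for $\tau>0$ it is the weak limit as $n\to\infty$ of the free multiplicative convolution powers $\nu_{\tau/n}^{\boxtimes n}$, where $\nu_c=(1-c)\delta_1+c\delta_0$. *)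

(* Defs.v *)
(* MathComp-Analysis, over an arbitrary [R : realType].  The measures live on
   [measurableTypeR R], i.e. [R] with its Borel sigma-algebra. *)
From HB Require Import structures.
From mathcomp Require Import all_boot all_order all_algebra.
From mathcomp Require Import all_classical all_reals all_analysis.

Set Implicit Arguments.
Unset Strict Implicit.
Unset Printing Implicit Defensive.

Import Order.TTheory GRing.Theory Num.Theory.
Import numFieldNormedType.Exports.

Local Open Scope classical_set_scope.
Local Open Scope ring_scope.

Section STransform.
Context {R : realType}.
Implicit Types mu : probability (measurableTypeR R) R.

Definition moment mu (p : nat) : R := \int[mu]_x (x ^+ p).

Definition psi mu (z : R) : R :=
  limn (fun n => \sum_(1 <= p < n) z ^+ p * moment mu p).

Definition inverse_near0 (f g : R -> R) : Prop :=
  [/\ f 0 = 0, g 0 = 0, {for 0, continuous g},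
      (\forall z \near (0 : R), g (f z) = z) &
      (\forall w \near (0 : R), f (g w) = w)].

(* [xget] selects an inverse if there is one (its germ at 0 is then unique) and
   is the zero function otherwise, e.g. when [mu] is the Dirac mass at 0. *)
Definition psi_inv mu : R -> R := xget (fun=> 0) (inverse_near0 (psi mu)).

(* Meaningful only for [w] close to 0 and, because of the quotient, [w != 0]:
   the value at 0 of the S-transform is a removable singularity. *)
Definition S_transform mu (w : R) : R := (1 + w) / w * psi_inv mu w.

End STransform.

Section ChargeTransferCumulants.
Context {R : realType}.
Implicit Types mu : probability (measurableTypeR R) R.

(* The closed interval matters: [mu] may have atoms at 0 and at 1. *)
Definition ct_generating_function mu (y : R) : R :=
  \int[mu]_(t in `[0, 1]) ln (1 + (expR y - 1) * t).

(* [kappa 0] plays no role and is normalised to 0. *)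
Definition ct_expansion mu (kappa : nat -> R) : Prop :=
  kappa 0%N = 0 /\
  \forall y \near (0 : R),
    (\sum_(1 <= r < n) kappa r * (y ^+ r / r`!%:R)) @[n --> \oo]
      --> ct_generating_function mu y.

(* There is at most one expansion.  Without one, [xget] would return the zero
   sequence, so [ct_cumulant mu r != 0] for some [r] entails that the expansion
   exists. *)
Definition ct_cumulant mu : nat -> R := xget (fun=> 0) (ct_expansion mu).

End ChargeTransferCumulants.

(* Main.v *)
Require Import Defs.
From HB Require Import structures.
From mathcomp Require Import all_boot all_order all_algebra.
From mathcomp Require Import all_classical all_reals all_analysis.
From mathcomp Require Import measurable_realfun ring lra.

(** Let psi be the moment series of mu and chi its inverse at 0.  Multiplying
    the hypothesis on the S-transform by w/(1+w) gives
    chi(w) = w/(1+w) e^{tau/(1+w)}, and the substitution w = v/(1-v), that is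
    1/(1+w) = 1-v, turns the identity psi(chi(w)) = w into
      psi(v e^{tau(1-v)}) = v/(1-v)       ([psi_functional_equation]).
    Both sides are explicit power series in v; comparing the coefficients of
    v, v^2, v^3 is a triangular system for the first three moments
    ([moments_of_S_transform]).

    On the other side, for fixed t in [0,1] the function
    y |-> log(1+(e^y-1)t) is the cumulant generating function of a Bernoulli
    variable of mean t.  Its derivative h has values in [0,1] and solves the
    logistic equation h' = h(1-h) with h(0) = t, so its derivative of order r
    is P_r(h) for the polynomials P_0 = X, P_{r+1} = P_r' (X - X^2).  The
    coefficients of P_r have absolute values summing to at most 2^r r!, hence
    the Taylor remainders of order n+1 are bounded by (2|y|)^n |y|, uniformly in
    t ([bernoulli_cgf_expansion]).  Because of this uniformity the expansion may
    be integrated against mu term by term: the cumulants exist and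
    kappa_{r+1} is the integral of P_r ([ct_cumulantE]).  In degrees 1, 2, 3 this
    reads m_1, m_1 - m_2, m_1 - 3 m_2 + 2 m_3 ([ct_cumulant_moments]), into which
    the moments are substituted.

    All comparisons of coefficients go through the relation [jet n f p]: f agrees
    with the polynomial p up to O(y^n) at 0.  It holds between the sum of
    a power series and its partial sums, is stable under composition, and
    determines the coefficients of p below n. *)

Import Order.TTheory GRing.Theory Num.Theory.
Import numFieldNormedType.Exports.

Set Implicit Arguments.
Unset Strict Implicit.
Unset Printing Implicit Defensive.

Local Open Scope classical_set_scope.
Local Open Scope ring_scope.

(** * Jets at 0 of real functions *)

Section PolyNear0.
Context {R : realFieldType}.
Implicit Types p : {poly R}.

Lemma horner_lipschitz p : exists2 L, 0 <= L &
  forall a b, `|a| <= 1 -> `|b| <= 1 -> `|p.[a] - p.[b]| <= L * `|a - b|.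
Proof.
elim/poly_ind: p => [|p c [L L0 pL]].
  by exists 0 => // a b _ _; rewrite !horner0 subrr normr0 mul0r.
have B0 : 0 <= `|p.[0]| + L by rewrite addr_ge0.
exists (`|p.[0]| + L + L) => [|a b a1 b1]; first by rewrite addr_ge0.
have pa : `|p.[a]| <= `|p.[0]| + L.
  rewrite -lerBlDl; apply: le_trans (lerB_dist _ _) _.
  by apply: le_trans (pL a 0 a1 _) _; rewrite ?normr0 ?subr0 ?ler_piMr.
rewrite !hornerMXaddC.
have -> : p.[a] * a + c - (p.[b] * b + c)
          = p.[a] * (a - b) + (p.[a] - p.[b]) * b by ring.
apply: le_trans (ler_normD _ _) _; rewrite !normrM mulrDl lerD//.
  by rewrite ler_wpM2r.
by apply: le_trans (ler_piMr _ b1) _ => //; exact: pL.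
Qed.

(** The values at positive points suffice.  The constant coefficient vanishes by
    continuity, after which the estimate can be divided by [y != 0]. *)
Lemma coef_eq0_of_bigO p (C e : R) n : 0 < e ->
  (forall y, 0 < y < e -> `|p.[y]| <= C * y ^+ n) ->
  forall i, (i < n)%N -> p`_i = 0.
Proof.
move=> e0; elim: n p => // n IHn p pC.
have p00 : p.[0] = 0.
  apply/eqP; rewrite -normr_eq0 eq_le normr_ge0 andbT.
  have [L L0 pL] := horner_lipschitz p.
  apply/ler_addgt0Pr => d d0; rewrite add0r.
  have K0 : 0 < `|C| + L + 1 by rewrite ltr_wpDl ?addr_ge0.
  (* small enough for [y < e], [y <= 1] and for [|p.[0]|], which is bounded by
     [(|C| + L) * y], to be at most [d] *)
  pose y := Num.min (Num.min (e / 2) 1) (d / (`|C| + L + 1)).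
  have y0 : 0 < y by rewrite !lt_min !divr_gt0 //= ltr01.
  have y1 : y <= 1 by rewrite !ge_min lexx orbT.
  have ye : y < e by rewrite !gt_min ltr_pdivrMr// ltr_pMr// ltr1n.
  have yd : y * (`|C| + L + 1) <= d by rewrite -ler_pdivlMr// ge_min lexx orbT.
  have ny : `|y| = y by rewrite gtr0_norm.
  have : `|p.[0]| <= `|p.[y]| + `|p.[y] - p.[0]|.
    by rewrite -{1}(subKr p.[y] p.[0]); exact: ler_normB.
  move/le_trans; apply; apply: le_trans yd.
  have h1 : `|p.[y]| <= `|C| * y.
    apply: le_trans (pC y _) _; first by rewrite y0.
    apply: (@le_trans _ _ (`|C| * y ^+ n.+1)).
      by rewrite ler_wpM2r ?ler_norm// exprn_ge0 ?ltW.
    by rewrite ler_wpM2l// exprS ler_piMr// ?exprn_ile1// ltW.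
  have := pL y 0; rewrite ny normr0 subr0 ny => /(_ y1 ler01) h2.
  by nra.
have [q pE] : exists q : {poly R}, p = q * 'X.
  have /factor_theorem[q ->] : root p 0 by exact/eqP.
  by exists q; rewrite subr0.
move=> [_|i]; first by rewrite -horner_coef0.
rewrite ltnS pE coefMX /=; apply: IHn => y /andP[y0 ye].
have := pC y.
rewrite y0 ye pE hornerM hornerX normrM (gtr0_norm y0) exprSr mulrA.
by move=> /(_ isT); rewrite ler_pM2r.
Qed.
End PolyNear0.

Section Jet.
Context {R : realType}.
Implicit Types (f g : R -> R) (p q : {poly R}) (n : nat).

(** Only the coefficients of [p] below [n] are determined by [f]; leaving the others
    free avoids truncating products and compositions. *)
Definition jet n f p := exists C, \forall y \near (0 : R),
  `|f y - p.[y]| <= C * `|y| ^+ n.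

Lemma jet_uniq n f p q : jet n f p -> jet n f q ->
  forall i, (i < n)%N -> p`_i = q`_i.
Proof.
move=> [C fp] [D fq] i ilt.
have /nbhs_norm0P[e /= e0 eP] : \forall y \near (0 : R),
    `|(p - q).[y]| <= (C + D) * `|y| ^+ n.
  near=> y; rewrite hornerD hornerN.
  have -> : p.[y] - q.[y] = (f y - q.[y]) - (f y - p.[y]) by ring.
  apply: le_trans (ler_normB _ _) _; rewrite addrC mulrDl lerD//.
    by near: y.
  by near: y.
have : (p - q)`_i = 0.
  apply: (coef_eq0_of_bigO e0 _ ilt) => y /andP[y0 ye].
  by have := eP y; rewrite /= (gtr0_norm y0); exact.
by rewrite coefB => /eqP; rewrite subr_eq0 => /eqP.
Unshelve. all: by end_near. Qed.

Lemma eq_jet n f g p : (\forall y \near (0 : R), f y = g y) ->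
  jet n f p -> jet n g p.
Proof.
move=> fg [C fp]; exists C; near=> y.
have <- : f y = g y by near: y.
by near: y.
Unshelve. all: by end_near. Qed.

Lemma jetM_horner n f p q : jet n f p -> jet n (fun y => q.[y] * f y) (q * p).
Proof.
move=> [C fp]; have [L L0 qL] := horner_lipschitz q.
exists ((`|q.[0]| + L) * C); near=> y.
have /ltW y1 : `|y| < 1 by near: y; exact: (@nbhs0_lt _ R^o).
rewrite hornerM -mulrBr normrM -mulrA; apply: ler_pM => //; last by near: y.
rewrite -lerBlDl; apply: le_trans (lerB_dist _ _) _.
apply: le_trans (qL y 0 y1 _) _; first by rewrite normr0.
by rewrite subr0 ler_piMr.
Unshelve. all: by end_near. Qed.

(** Since [q.[0] = 0], [g y] is of the order of [y], so the error of [p] at [g y] is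
    still [O(y^n)]; replacing [g y] by [q.[y]] inside [p] costs [O(y^n)] because
    polynomials are Lipschitz near 0. *)
Lemma jet_comp n f g p q : jet n f p -> jet n g q -> (0 < n)%N -> q.[0] = 0 ->
  jet n (f \o g) (p \Po q).
Proof.
move=> [C fp] [D gq] n0 q0.
have [L L0 qL] := horner_lipschitz q; have [P P0 pP] := horner_lipschitz p.
have C0 : 0 <= `|C| by [].
have D0 : 0 <= `|D| by [].
pose K := L + `|D| + 1; have K0 : 0 < K by rewrite ltr_wpDl ?addr_ge0.
have /nbhs_norm0P[e /= e0 eP] := fp.
exists (`|C| * K ^+ n + P * `|D|); near=> y.
have /ltW y1 : `|y| < 1 by near: y; exact: (@nbhs0_lt _ R^o).
have yK : `|y| < K^-1 by near: y; apply: (@nbhs0_lt _ R^o); rewrite invr_gt0.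
have ye : `|y| < e / K by near: y; apply: (@nbhs0_lt _ R^o); rewrite divr_gt0.
have Ky1 : K * `|y| <= 1 by rewrite -ler_pdivlMl// mulr1 ltW.
have gqy : `|g y - q.[y]| <= `|D| * `|y| ^+ n.
  apply: (@le_trans _ _ (D * `|y| ^+ n)); first by near: y.
  by rewrite ler_wpM2r ?ler_norm// exprn_ge0.
have yn : `|y| ^+ n <= `|y|.
  by case: (n) n0 => // m _; rewrite exprS ler_piMr// exprn_ile1.
have qy : `|q.[y]| <= L * `|y|.
  by have := qL y 0 y1; rewrite normr0 q0 !subr0; apply.
have gy : `|g y| <= K * `|y|.
  rewrite -(subrK q.[y] (g y)); apply: le_trans (ler_normD _ _) _.
  apply: le_trans (lerD gqy qy) _.
  have := ler_wpM2l D0 yn; rewrite /K !mulrDl mul1r; have := normr_ge0 y; lra.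
have qy1 : `|q.[y]| <= 1.
  apply: le_trans qy (le_trans _ Ky1).
  by rewrite ler_wpM2r// /K -addrA lerDl addr_ge0.
have -> : (f \o g) y - (p \Po q).[y] =
    (f (g y) - p.[g y]) + (p.[g y] - p.[q.[y]]) by rewrite horner_comp /=; ring.
apply: le_trans (ler_normD _ _) _; rewrite mulrDl; apply: lerD.
  apply: le_trans (eP (g y) _) _.
    by apply: le_lt_trans gy _; rewrite mulrC -ltr_pdivlMr.
  apply: (@le_trans _ _ (`|C| * `|g y| ^+ n)).
    by rewrite ler_wpM2r ?ler_norm// exprn_ge0.
  by rewrite -mulrA -exprMn ler_wpM2l// lerXn2r ?nnegrE// mulr_ge0// ltW.
apply: le_trans (pP _ _ (le_trans gy Ky1) qy1) _.
by rewrite -mulrA ler_wpM2l.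
Unshelve. all: by end_near. Qed.

(** Convergence at one point [r > 0] bounds [c k] by [K / r ^ k]; for
    [|y| < r / 2] the tail of the series is then dominated by a geometric series of
    ratio less than 1/2. *)
Lemma jet_series n (c : nat -> R) f :
  (\forall y \near (0 : R), series (fun k => c k * y ^+ k) @ \oo --> f y) ->
  jet n f (\poly_(i < n) c i).
Proof.
move=> /nbhs_norm0P[e /= e0 eP].
pose r := e / 2; have r0 : 0 < r by rewrite divr_gt0.
have re : `|r| < e by rewrite gtr0_norm// ltr_pdivrMr// ltr_pMr// ltr1n.
have [M [_ MP]] := cvg_series_bounded (cvgP _ (eP r re)).
pose K := `|M| + 1; have K0 : 0 <= K by rewrite addr_ge0.
have cK k : `|c k| <= K / r ^+ k.
  rewrite ler_pdivlMr ?exprn_gt0//.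
  rewrite -[X in _ * X ^+ _](gtr0_norm r0) -normrX -normrM.
  by apply: (MP K) => //; rewrite ltr_pwDr// ler_norm.
exists (2 * K / r ^+ n); near=> y.
have yr : `|y| < r / 2 by near: y; apply: (@nbhs0_lt _ R^o); rewrite divr_gt0.
pose x := `|y| / r.
have x0 : 0 <= x by rewrite divr_ge0// ltW.
have xE k : x ^+ k = `|y| ^+ k / r ^+ k by exact: expr_div_n.
have x2 : x < 1 / 2 by rewrite ltr_pdivrMr// mulrC mulrA mulr1.
have ye : `|y| < e.
  apply: lt_trans yr (lt_trans _ re).
  by rewrite gtr0_norm// ltr_pdivrMr// ltr_pMr// ltr1n.
have -> : 2 * K / r ^+ n * `|y| ^+ n = 2 * K * x ^+ n.
  by rewrite xE -!mulrA (mulrC _^-1).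
rewrite horner_poly.
have /cvgB := eP y ye.
move=> /(_ _ _ (cvg_cst (\sum_(i < n) c i * y ^+ i))) /cvg_norm cf.
rewrite -(cvg_lim _ cf)//; apply: limr_le; first exact: cvgP cf.
exists n => // m /= nm.
have -> : (series (fun k => c k * y ^+ k) - cst (\sum_(i < n) c i * y ^+ i)) m
   = \sum_(n <= k < n + (m - n)) c k * y ^+ k.
  rewrite subnKC// -sub_series_geq //; congr (_ - _).
  by rewrite /series /= big_mkord.
apply: (@le_trans _ _ (\sum_(n <= k < n + (m - n)) K * x ^+ k)).
  apply: le_trans (ler_norm_sum _ _ _) _; apply: ler_sum => k _.
  rewrite normrM normrX (le_trans (ler_wpM2r _ (cK k)))//.
  by rewrite xE -mulrA (mulrC _^-1).
rewrite -mulr_sumr geometric_partial_tail geometric_seriesE; last first.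
  by rewrite lt_eqF//; lra.
have le2 : (1 - x ^+ (m - n)) / (1 - x) <= 2.
  have := exprn_ge0 (m - n) x0; rewrite ler_pdivrMr; lra.
rewrite /= [2 * K]mulrC -!mulrA ler_wpM2l// [2 * _]mulrC ler_wpM2l//.
exact: exprn_ge0.
Unshelve. all: by end_near. Qed.
End Jet.

(** * Taylor's inequality *)

Section Taylor.
Context {R : realType}.

Lemma ge0_of_derive_ge0 (g dg : R -> R) :
  (forall x : R, is_derive x 1 g (dg x)) ->
  g 0 = 0 -> (forall x, 0 <= x -> 0 <= dg x) -> forall x, 0 <= x -> 0 <= g x.
Proof.
move=> g' g0 dg0 x x0.
have [|c] := MVT_segment x0 (fun y _ => g' y).
  apply: derivable_within_continuous => y _; exact: ex_derive.
rewrite g0 !subr0 => /itvP c0 ->.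
by rewrite mulr_ge0// dg0// c0.
Qed.

Definition taylor_poly n (f : nat -> R -> R) : {poly R} :=
  \poly_(k < n) (f k 0 / k`!%:R).

Lemma deriv_taylor_poly n f :
  (taylor_poly n.+1 f)^`() = taylor_poly n (fun k => f k.+1).
Proof.
apply/polyP => i; rewrite coef_deriv !coef_poly ltnS.
case: ifP => _; last by rewrite mul0rn.
rewrite -mulr_natr factS natrM; field.
by rewrite nat1r !pnatr_eq0 -lt0n fact_gt0.
Qed.

(** By induction on [n] the derivative of the remainder is dominated by the
    derivative of [q = M / n! * 'X^n]; hence [q] plus or minus the remainder is
    nondecreasing on the positive half-line, and it vanishes at 0. *)
Lemma taylor_bound_ge0 n (f : nat -> R -> R) M :
  (forall k (x : R), is_derive x 1 (f k) (f k.+1 x)) ->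
  (forall x, `|f n x| <= M) ->
  forall x, 0 <= x -> `|f 0%N x - (taylor_poly n f).[x]| <= M / n`!%:R * x ^+ n.
Proof.
elim: n f => [|n IHn] f f' fM x x0.
  by rewrite /taylor_poly poly_def big_ord0 horner0 subr0 expr0 mulr1 divr1.
pose q := (M / n.+1`!%:R) *: 'X^(n.+1).
have dq y : q^`().[y] = M / n`!%:R * y ^+ n.
  rewrite /q derivZ derivXn /= hornerZ hornerMn hornerXn -mulr_natr.
  rewrite factS natrM; field.
  by rewrite nat1r !pnatr_eq0 -lt0n fact_gt0.
have dbound y (y0 : 0 <= y) :
    `|f 1%N y - (taylor_poly n.+1 f)^`().[y]| <= q^`().[y].
  by rewrite deriv_taylor_poly dq; exact: (IHn (fun k => f k.+1)).
have q0 : q.[0] = 0 by rewrite hornerZ hornerXn expr0n mulr0.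
have t0 : (taylor_poly n.+1 f).[0] = f 0%N 0.
  by rewrite horner_coef0 coef_poly /= divr1.
have -> : M / n.+1`!%:R * x ^+ n.+1 = q.[x] by rewrite hornerZ hornerXn.
rewrite ler_norml; apply/andP; split.
- rewrite -subr_ge0 opprK.
  apply: (@ge0_of_derive_ge0
    (f 0%N - horner (taylor_poly n.+1 f) + horner q)
    (fun y => f 1%N y - (taylor_poly n.+1 f)^`().[y] + q^`().[y])) => //.
    by rewrite !fctE q0 t0 subrr addr0.
  by move=> y /dbound; rewrite ler_norml => /andP[+ _]; rewrite -subr_ge0 opprK.
- rewrite -subr_ge0.
  apply: (@ge0_of_derive_ge0
    (horner q - (f 0%N - horner (taylor_poly n.+1 f)))
    (fun y => q^`().[y] - (f 1%N y - (taylor_poly n.+1 f)^`().[y]))) => //.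
    by rewrite !fctE q0 t0 !subrr.
  by move=> y /dbound; rewrite ler_norml => /andP[_]; rewrite -subr_ge0.
Qed.

Lemma taylor_bound n (f : nat -> R -> R) M :
  (forall k (x : R), is_derive x 1 (f k) (f k.+1 x)) ->
  (forall x, `|f n x| <= M) ->
  forall x, `|f 0%N x - (taylor_poly n f).[x]| <= M / n`!%:R * `|x| ^+ n.
Proof.
move=> f' fM x; have [x0|x0] := leP 0 x.
  by rewrite (ger0_norm x0); exact: (taylor_bound_ge0 f').
(* the successive derivatives of [y |-> f 0 (- y)] *)
pose g k y := (-1) ^+ k * f k (- y).
have g' k (y : R) : is_derive y 1 (g k) (g k.+1 y).
  have -> : g k.+1 y = (-1) ^+ k *: (f k.+1 (- y) * -1).
    by rewrite /g exprS /= /GRing.scale /=; ring.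
  exact: is_deriveZ.
have gM y : `|g n y| <= M by rewrite normrM normrX normrN1 expr1n mul1r.
have := taylor_bound_ge0 g' gM (_ : 0 <= - x).
rewrite oppr_ge0 ltW// => /(_ isT).
rewrite /g expr0 mul1r opprK (ltr0_norm x0); congr (`|_ - _| <= _).
rewrite !horner_poly; apply: eq_bigr => k _.
have s : (-1) ^+ k * (-1) ^+ k = 1 :> R.
  by rewrite -exprMn mulrNN mulr1 expr1n.
by rewrite [(- x) ^+ k]exprNn oppr0 -[RHS]mul1r -[X in _ = X * _]s; ring.
Qed.
End Taylor.

(** * Cumulants of Bernoulli variables *)

Section LogisticPolynomials.
Context {R : realType}.
Implicit Types (p : {poly R}).

(** If [h' = h (1 - h)], then [logistic_step p] evaluated at [h] is the derivative
    of [p] evaluated at [h]. *)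
Definition logistic_step p : {poly R} := p^`() * ('X - 'X^2).

Definition logistic_poly r : {poly R} := iter r logistic_step 'X.

Lemma coef_logistic_step p i :
  (logistic_step p)`_i = p`_i *+ i - (if i is j.+1 then p`_j *+ j else 0).
Proof.
have cX k : (p^`() * 'X)`_k = p`_k *+ k.
  by rewrite coefMX coef_deriv; case: k.
have -> : logistic_step p = p^`() * 'X - p^`() * 'X * 'X.
  by rewrite /logistic_step; ring.
by rewrite coefB cX coefMX; case: i => //= j; rewrite cX.
Qed.

Lemma size_logistic_poly r : (size (logistic_poly r) <= r.+2)%N.
Proof.
elim: r => [|r IHr]; first by rewrite size_polyX.
apply/leq_sizeP => i ri; rewrite coef_logistic_step.
case: i ri => // i ri; move/leq_sizeP: IHr => IHr.
by rewrite !IHr// ?mul0rn ?subrr// ltnW.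
Qed.

(** On polynomials of degree at most [n], [p |-> p^`() * 'X] multiplies the sum of the
    absolute values of the coefficients by at most [n], and [logistic_step p] is
    the difference of that polynomial and its product with ['X]. *)
Lemma logistic_poly_coef_bound r :
  \sum_(i < r.+2) `|(logistic_poly r)`_i| <= 2 ^+ r * r`!%:R.
Proof.
elim: r => [|r IHr].
  by rewrite !big_ord_recl big_ord0 !coefX /= normr0 normr1 add0r addr0 mulr1.
set p := logistic_poly r in IHr *.
(* the sum of the absolute values of the coefficients of [p^`() * 'X] *)
pose S : R := \sum_(i < r.+2) `|p`_i *+ i|.
have S0 : S <= r.+1%:R * (2 ^+ r * r`!%:R).
  apply: le_trans (ler_wpM2l (ler0n _ _) IHr).
  rewrite mulr_sumr; apply: ler_sum => i _.
  by rewrite normrMn -[leLHS]mulr_natl ler_wpM2r// ler_nat -ltnS.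
have p0 : p`_r.+2 = 0 by have /leq_sizeP := size_logistic_poly r; exact.
apply: (@le_trans _ _ (S + S)); last first.
  by rewrite exprS factS natrM; lra.
apply: (@le_trans _ _ (\sum_(i < r.+3)
    (`|p`_i *+ i| + `|if val i is j.+1 then p`_j *+ j else 0|))).
  apply: ler_sum => i _; rewrite [logistic_poly _]/= -/(logistic_poly r).
  by rewrite coef_logistic_step; exact: ler_normB.
rewrite big_split /=; apply: lerD.
  by rewrite big_ord_recr /= p0 mul0rn normr0 addr0.
by rewrite big_ord_recl /= normr0 add0r.
Qed.

Lemma logistic_poly_bound r x : 0 <= x <= 1 ->
  `|(logistic_poly r).[x]| <= 2 ^+ r * r`!%:R.
Proof.
move=> /andP[x0 x1]; apply: le_trans (logistic_poly_coef_bound r).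
rewrite (horner_coef_wide _ (size_logistic_poly r)).
apply: le_trans (ler_norm_sum _ _ _) _; apply: ler_sum => i _.
by rewrite normrM normrX (ger0_norm x0) ler_piMr// exprn_ile1.
Qed.

End LogisticPolynomials.

Section BernoulliCumulants.
Context {R : realType}.
Implicit Types t y : R.

Definition bernoulli_cgf t y : R := ln (1 + (expR y - 1) * t).

(** The derivative of [bernoulli_cgf t]: the mean of the Bernoulli variable after
    reweighting by [expR (y * _)], which is why it stays in the unit interval. *)
Definition tilted_mean t y : R := t * expR y / (1 + (expR y - 1) * t).

Lemma bernoulli_mgf_gt0 t y : 0 <= t <= 1 -> 0 < 1 + (expR y - 1) * t.
Proof.
move=> /andP[t0 t1]; have e0 := expR_gt0 y.
have [->|tn0] := eqVneq t 0; first by rewrite mulr0 addr0.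
have : 0 < expR y * t by rewrite mulr_gt0// lt_def tn0.
lra.
Qed.

Lemma tilted_mean_itv t y : 0 <= t <= 1 -> 0 <= tilted_mean t y <= 1.
Proof.
move=> t01; have d0 := bernoulli_mgf_gt0 y t01; move/andP: t01 => [t0 t1].
rewrite /tilted_mean ler_pdivrMr// divr_ge0 ?mulr_ge0 ?expR_ge0 ?(ltW d0)//=.
lra.
Qed.

Lemma is_derive_bernoulli_mgf t y :
  is_derive y 1 (fun z => 1 + (expR z - 1) * t) (expR y * t).
Proof.
apply: trigger_derive; rewrite /GRing.scale /=; ring.
Qed.

Lemma is_derive_bernoulli_cgf t y : 0 <= t <= 1 ->
  is_derive y 1 (bernoulli_cgf t) (tilted_mean t y).
Proof.
move=> t01; have d0 := bernoulli_mgf_gt0 y t01.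
have := @is_derive1_comp _ (@ln R) (fun z => 1 + (expR z - 1) * t) y _ _
  (is_derive1_ln d0) (is_derive_bernoulli_mgf t y).
by rewrite [_^-1 * _]mulrC [expR y * t]mulrC.
Qed.

Lemma is_derive_tilted_mean t y : 0 <= t <= 1 ->
  is_derive y 1 (tilted_mean t) (tilted_mean t y * (1 - tilted_mean t y)).
Proof.
move=> t01; have d0 := bernoulli_mgf_gt0 y t01.
have dn0 : 1 + (expR y - 1) * t != 0 by rewrite gt_eqF.
have dV := @is_deriveV _ (fun z => 1 + (expR z - 1) * t) _ _ _ dn0
  (is_derive_bernoulli_mgf t y).
have dN : is_derive y 1 (fun z => t * expR z) (t * expR y).
  by apply: trigger_derive; rewrite /GRing.scale /=; ring.
have := is_deriveM dN dV.
move=> /trigger_derive; apply.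
rewrite /tilted_mean /GRing.scale /=; field.
by [].
Qed.

Definition bernoulli_cgf_deriv t k : R -> R :=
  if k is r.+1 then fun y => (logistic_poly r).[tilted_mean t y]
  else bernoulli_cgf t.

Lemma is_derive_bernoulli_cgf_deriv t k y : 0 <= t <= 1 ->
  is_derive y 1 (bernoulli_cgf_deriv t k) (bernoulli_cgf_deriv t k.+1 y).
Proof.
move=> t01; case: k => [|r] /=.
  by rewrite hornerX; exact: is_derive_bernoulli_cgf.
have := is_derive1_comp (is_derive_poly (logistic_poly r) (tilted_mean t y))
  (is_derive_tilted_mean y t01).
move=> /trigger_derive; apply.
by rewrite hornerM hornerD hornerN hornerX hornerXn; ring.
Qed.

Lemma tilted_mean0 t : tilted_mean t 0 = t.
Proof. by rewrite /tilted_mean expR0 subrr mul0r addr0 mulr1 divr1. Qed.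

Definition bernoulli_cumulant t k : R :=
  if k is r.+1 then (logistic_poly r).[t] else 0.

(** The derivative of order [n.+1] is bounded by [2 ^ n * n!] on the whole line,
    for every [t]; so the expansion converges for [|y| < 1 / 2], uniformly in [t]. *)
Lemma bernoulli_cgf_expansion n t y : 0 <= t <= 1 ->
  `|bernoulli_cgf t y
    - \sum_(k < n.+1) bernoulli_cumulant t k * (y ^+ k / k`!%:R)|
  <= (2 * `|y|) ^+ n * `|y|.
Proof.
move=> t01.
have := taylor_bound (n := n.+1) (f := bernoulli_cgf_deriv t)
  (M := 2 ^+ n * n`!%:R)
  (fun k x => is_derive_bernoulli_cgf_deriv k x t01)
  (fun x => logistic_poly_bound n (tilted_mean_itv x t01)) y.
rewrite horner_poly.
have -> : \sum_(k < n.+1) bernoulli_cgf_deriv t k 0 / k`!%:R * y ^+ k =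
    \sum_(k < n.+1) bernoulli_cumulant t k * (y ^+ k / k`!%:R).
  apply: eq_bigr => -[[|k] _] _ /=; last by rewrite tilted_mean0 mulrAC mulrA.
  by rewrite /bernoulli_cgf expR0 subrr mul0r addr0 ln1 !mul0r.
move=> /le_trans; apply.
rewrite exprSr exprMn mulrA ler_wpM2r// ler_wpM2r ?exprn_ge0//.
rewrite factS natrM -mulrA ler_piMr ?exprn_ge0//.
rewrite ler_pdivrMr ?mul1r ?mulr_gt0 ?ltr0n ?fact_gt0//.
by rewrite ler_peMl ?ler0n// ler1n.
Qed.

End BernoulliCumulants.

(** * Moments and charge-transfer cumulants of a measure on the unit interval *)

Section UnitIntervalIntegrals.
Context {R : realType} (mu : probability (measurableTypeR R) R).
Context (mu01 : mu `[0, 1]%classic = 1%E).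
Local Notation I := (`[0, 1]%classic : set (measurableTypeR R)).

Lemma measurable_unit_itv : measurable I.
Proof. exact: measurable_itv. Qed.
Local Hint Resolve measurable_unit_itv : core.

Lemma Rintegral_unit_itv_cst r : \int[mu]_(t in I) r = r.
Proof. by rewrite Rintegral_cst// [X in fine X]mu01 mulr1. Qed.

Lemma integrable_unit_itv (f : R -> R) M :
  measurable_fun I f -> (forall t, 0 <= t <= 1 -> `|f t| <= M) ->
  mu.-integrable I (EFin \o f).
Proof.
move=> mf fM; apply: measurable_bounded_integrable => //.
  by have := ltry (1 : R); rewrite -mu01.
exists M; split; first exact: num_real.
move=> x Mx t /= /[!in_itv] /= t01; exact: le_trans (fM t t01) (ltW Mx).
Qed.

Lemma measurable_horner_unit_itv (p : {poly R}) : measurable_fun I (horner p).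
Proof.
apply: measurable_funTS; apply: continuous_measurable_fun.
exact: continuous_horner.
Qed.

Lemma integrable_horner_unit_itv (p : {poly R}) :
  mu.-integrable I (EFin \o horner p).
Proof.
have [L L0 pL] := horner_lipschitz p.
apply: (@integrable_unit_itv _ (`|p.[0]| + L)).
  exact: measurable_horner_unit_itv.
move=> t /andP[t0 t1]; rewrite -lerBlDl; apply: le_trans (lerB_dist _ _) _.
have tn : `|t| <= 1 by rewrite ger0_norm.
by apply: le_trans (pL t 0 tn _) _; rewrite ?normr0 ?subr0 ?ler_piMr.
Qed.

Lemma Rintegral_hornerD (p q : {poly R}) :
  \int[mu]_(t in I) (p + q).[t] =
  \int[mu]_(t in I) p.[t] + \int[mu]_(t in I) q.[t].
Proof.
under eq_Rintegral do rewrite hornerD.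
by apply: RintegralD => //; exact: integrable_horner_unit_itv.
Qed.

Lemma Rintegral_hornerZ a (p : {poly R}) :
  \int[mu]_(t in I) (a *: p).[t] = a * \int[mu]_(t in I) p.[t].
Proof.
under eq_Rintegral do rewrite hornerZ.
by apply: RintegralZl => //; exact: integrable_horner_unit_itv.
Qed.

(** Moments are integrals over the whole line; the complement of the unit interval
    is negligible. *)
Lemma momentE p : moment mu p = \int[mu]_(t in I) ('X^p).[t].
Proof.
rewrite /moment /Rintegral; congr fine.
have muC : mu (~` I) = 0%E.
  by rewrite probability_setC// mu01 subee.
have mC : measurable (~` I) by exact: measurableC.
have eI : [set: measurableTypeR R] `\` ~` I = I by rewrite setTD setCK.
under [RHS]eq_integral do rewrite hornerXn.
rewrite (negligible_integral mC measurableT) ?eI//.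
apply/(negligible_integrable mC measurableT) => //; last first.
  rewrite eI; have := integrable_horner_unit_itv 'X^p.
  by apply: eq_integrable => // t _; rewrite /= hornerXn.
by apply/measurable_EFinP; exact: exprn_measurable.
Qed.

Lemma moment_bound p : `|moment mu p| <= 1.
Proof.
rewrite momentE; apply: le_trans (le_normr_Rintegral _ _) _ => //.
  exact: integrable_horner_unit_itv.
apply: (@le_trans _ _ (\int[mu]_(t in I) 1)); last first.
  by rewrite Rintegral_unit_itv_cst.
apply: le_Rintegral => //.
- apply: (@integrable_unit_itv (fun t => `|('X^p).[t]|) 1).
    by apply: measurableT_comp => //; exact: measurable_horner_unit_itv.
  move=> t /andP[t0 t1]; rewrite normr_id hornerXn normrX ger0_norm//.
  exact: exprn_ile1.
- by apply: (@integrable_unit_itv (cst 1) 1) => // t _; rewrite normr1.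
- move=> t /=; rewrite in_itv /= => /andP[t0 t1].
  by rewrite hornerXn normrX ger0_norm// exprn_ile1.
Qed.

(** The moments of a measure on the unit interval are bounded by 1, so the moment
    series converges on the open unit disc. *)
Lemma jet_psi n :
  jet n (psi mu) (\poly_(i < n) (if i == 0%N then 0 else moment mu i)).
Proof.
apply: jet_series; near=> z.
have z1 : `|z| < 1 by near: z; exact: (@nbhs0_lt _ R^o).
pose c k : R := if k == 0%N then 0 else moment mu k.
rewrite -/(c _).
have -> : psi mu z = limn (series (fun k => c k * z ^+ k)).
  rewrite /psi; congr (lim (_ @ \oo)); apply/funext => -[|m].
    by rewrite /series /= !big_geq.
  rewrite /series /= [RHS]big_ltn// /c /= mul0r add0r.
  by rewrite !big_add1 /=; apply: eq_bigr => k _; rewrite mulrC.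
suff : cvgn (series (fun k => c k * z ^+ k)) by [].
apply: normed_cvg.
apply: (@series_le_cvg _ _ (geometric 1 `|z|)) => //=.
- move=> k; rewrite normrM normrX ler_wpM2r// /c.
  by case: eqP => _; rewrite ?normr0 ?ler01// moment_bound.
- by apply: is_cvg_geometric_series; rewrite normr_id.
Unshelve. all: by end_near. Qed.

Definition mean_cumulant k : R := \int[mu]_(t in I) bernoulli_cumulant t k.

(** The bound of [bernoulli_cgf_expansion] does not depend on [t], so it passes to
    the mean with respect to [mu]. *)
Lemma ct_generating_function_bound n y :
  `|ct_generating_function mu y
    - \sum_(k < n.+1) mean_cumulant k * (y ^+ k / k`!%:R)|
  <= (2 * `|y|) ^+ n * `|y|.
Proof.
(* Bernoulli cumulants are polynomials in [t], hence so is the partial sum *)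
pose Q k : {poly R} := if k is r.+1 then logistic_poly r else 0.
have QE t k : bernoulli_cumulant t k = (Q k).[t].
  by case: k => //=; rewrite horner0.
pose P := \sum_(k < n.+1) (y ^+ k / k`!%:R) *: Q k.
have PE t : P.[t] = \sum_(k < n.+1) bernoulli_cumulant t k * (y ^+ k / k`!%:R).
  by rewrite horner_sum; apply: eq_bigr => k _; rewrite hornerZ QE mulrC.
have -> : \sum_(k < n.+1) mean_cumulant k * (y ^+ k / k`!%:R) =
    \int[mu]_(t in I) P.[t].
  rewrite /P; elim/big_rec2: _ => [|k a p _ ->].
    by under eq_Rintegral do rewrite horner0; rewrite Rintegral_unit_itv_cst.
  rewrite Rintegral_hornerD Rintegral_hornerZ mulrC; congr (_ * _ + _).
  by apply: eq_Rintegral => t _; rewrite QE.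
have bnd t : 0 <= t <= 1 ->
    `|bernoulli_cgf t y - P.[t]| <= (2 * `|y|) ^+ n * `|y|.
  by move=> t01; rewrite PE; exact: bernoulli_cgf_expansion.
have mP : measurable_fun I (horner P).
  exact: measurable_horner_unit_itv.
have mF : measurable_fun I (bernoulli_cgf ^~ y).
  apply: measurable_funTS; apply: measurableT_comp; first exact: measurable_ln.
  by apply: measurable_funD => //; apply: measurable_funM.
have iP := integrable_horner_unit_itv P.
have iB : mu.-integrable I (EFin \o (fun t => bernoulli_cgf t y - P.[t])).
  by apply: (integrable_unit_itv _ bnd); exact: measurable_funB.
have iF : mu.-integrable I (EFin \o (bernoulli_cgf ^~ y)).
  apply: (@integrable_unit_itv _ `|y|) => // t t01.
  have := bernoulli_cgf_expansion 0 y t01.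
  by rewrite big_ord1 /= mul0r subr0 expr0 mul1r.
rewrite -RintegralB//.
apply: le_trans (le_normr_Rintegral _ _) _ => //.
apply: (@le_trans _ _ (\int[mu]_(t in I) ((2 * `|y|) ^+ n * `|y|))); last first.
  by rewrite Rintegral_unit_itv_cst.
apply: le_Rintegral => //.
- apply: (@integrable_unit_itv (fun t => `|bernoulli_cgf t y - P.[t]|)).
    by apply: measurableT_comp => //; exact: measurable_funB.
  by move=> t t01; rewrite normr_id; exact: bnd.
- by apply: integrable_unit_itv.
Qed.

Lemma ct_expansion_mean_cumulant : ct_expansion mu mean_cumulant.
Proof.
have c0 : mean_cumulant 0 = 0 by exact: Rintegral_unit_itv_cst.
split=> //; near=> y.
have y2 : `|y| < 1 / 2 by near: y; exact: (@nbhs0_lt _ R^o).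
have y1 : `|2 * `|y| | < 1 by rewrite ger0_norm ?mulr_ge0//; lra.
rewrite -cvg_shiftS /=; apply/cvgrPdist_le => e e0.
have /cvgrPdist_le /(_ e e0) := cvg_geometric `|y| y1.
apply: filterS => n; rewrite sub0r normrN /= => ne.
have -> : \sum_(1 <= r < n.+1) mean_cumulant r * (y ^+ r / r`!%:R) =
    \sum_(r < n.+1) mean_cumulant r * (y ^+ r / r`!%:R).
  by rewrite -(big_mkord xpredT (fun r => mean_cumulant r * (y ^+ r / r`!%:R)))
     [RHS]big_ltn// c0 mul0r add0r.
apply: le_trans (ct_generating_function_bound n y) _.
by rewrite mulrC; apply: le_trans (ler_norm _) ne.
Unshelve. all: by end_near. Qed.

Lemma jet_ct_expansion n (kappa : nat -> R) : ct_expansion mu kappa ->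
  jet n (ct_generating_function mu) (\poly_(i < n) (kappa i / i`!%:R)).
Proof.
move=> [k0 kF]; apply: jet_series; apply: filterS kF => y kF.
rewrite (_ : series _ = fun m =>
  \sum_(1 <= r < m) kappa r * (y ^+ r / r`!%:R))//.
apply/funext => -[|m].
  by rewrite /series /= !big_geq.
rewrite /series /= big_ltn// k0 !mul0r add0r.
by apply: eq_bigr => k _; rewrite mulrAC mulrA.
Qed.

(** [ct_cumulant] is some expansion as soon as there is one, and two expansions of
    the same function have the same jets. *)
Lemma ct_cumulantE r : ct_cumulant mu r = mean_cumulant r.
Proof.
have ex := ct_expansion_mean_cumulant.
have := jet_uniq (jet_ct_expansion r.+1 (xgetI (fun=> 0) ex))
  (jet_ct_expansion r.+1 ex) (ltnSn r).
rewrite !coef_poly ltnSn => /(congr1 ( *%R^~ r`!%:R)).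
by rewrite !divfK// pnatr_eq0 -lt0n fact_gt0.
Qed.

Lemma ct_cumulant_moments :
  [/\ ct_cumulant mu 1 = moment mu 1,
      ct_cumulant mu 2 = moment mu 1 - moment mu 2 &
      ct_cumulant mu 3 = moment mu 1 - 3 * moment mu 2 + 2 * moment mu 3].
Proof.
rewrite !ct_cumulantE /mean_cumulant /bernoulli_cumulant !momentE.
have P1 : logistic_poly 1 = 'X^1 + (-1) *: 'X^2 :> {poly R}.
  by rewrite /logistic_poly /= /logistic_step derivX scaleN1r; ring.
have P2 : logistic_poly 2 = 'X^1 + ((- 3) *: 'X^2 + 2 *: 'X^3) :> {poly R}.
  rewrite [LHS](_ : _ = logistic_step (logistic_poly 1))// P1 /logistic_step.
  rewrite derivD derivZ !derivXn /= -!mul_polyC; ring.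
split.
- by [].
- by rewrite P1 Rintegral_hornerD Rintegral_hornerZ mulN1r.
- by rewrite P2 !Rintegral_hornerD !Rintegral_hornerZ mulNr addrA.
Qed.

End UnitIntervalIntegrals.

(** * Moments from the S-transform *)

Section MomentsFromSTransform.
Context {R : realType}.

Lemma jet_expR n (a : R) :
  jet n (fun y => expR (a * y)) (\poly_(i < n) (a ^+ i / i`!%:R)).
Proof.
apply: jet_series; near=> y.
rewrite (_ : (fun k => _) = exp_coeff (a * y)); last first.
  by apply/funext => k; rewrite /exp_coeff /= exprMn mulrAC.
exact: is_cvg_series_exp_coeff.
Unshelve. all: by end_near. Qed.

Lemma jet_div1B n :
  jet n (fun y : R => y / (1 - y)) ('X * \poly_(i < n) 1).
Proof.
have : jet n (fun y : R => (1 - y)^-1) (\poly_(i < n) 1).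
  apply: jet_series; near=> y.
  have y1 : `|y| < 1 by near: y; exact: (@nbhs0_lt _ R^o).
  by have := @cvg_geometric_series R 1 y y1; rewrite mul1r.
move=> /(@jetM_horner _ _ _ _ 'X); apply: eq_jet.
by near=> y; rewrite hornerX.
Unshelve. all: by end_near. Qed.

Context (mu : probability (measurableTypeR R) R) (tau : R).
Context (mu_S : \forall z \near (0 : R)^',
  S_transform mu z = expR (tau / (1 + z))).

(** If [psi mu] had no local inverse, [psi_inv mu] and therefore the S-transform
    would be zero, whereas an exponential is not. *)
Lemma psi_inv_spec : inverse_near0 (psi mu) (psi_inv mu).
Proof.
apply: xgetPex; apply: contrapT => noinv.
have inv0 w : psi_inv mu w = 0.
  by rewrite /psi_inv xgetPN// => g gP; apply: noinv; exists g.
have [w] := @filter_ex _ _ (Proper_dnbhs_numFieldType (0 : R)) _ mu_S.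
rewrite /S_transform inv0 mulr0 => /eqP.
by rewrite eq_sym expR_eq0.
Qed.

Lemma psi_inv_near0 : \forall w \near (0 : R),
  psi_inv mu w = w / (1 + w) * expR (tau / (1 + w)).
Proof.
have [_ g0 _ _ _] := psi_inv_spec.
have : \forall w \near (0 : R), w != 0 ->
  S_transform mu w = expR (tau / (1 + w)) by exact: mu_S.
apply: filterS2 (@nbhs0_lt _ R^o _ ltr01) => w w1 Sw.
have [->|w0] := eqVneq w 0; first by rewrite g0 !mul0r.
have w1' : 1 + w != 0.
  by rewrite gt_eqF//; move: w1; rewrite ltr_norml => /andP[]; lra.
rewrite -Sw// /S_transform; field.
by rewrite w0.
Qed.

(** The relation [psi (psi_inv w) = w] at [w = v / (1 - v)], where
    [1 + w = (1 - v)^-1].  The variable [v] makes both the argument and the value of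
    [psi] elementary power series. *)
Lemma psi_functional_equation : \forall v \near (0 : R),
  psi mu (v * expR (tau * (1 - v))) = v / (1 - v).
Proof.
have [_ _ _ _ fg] := psi_inv_spec.
have [e /= e0 eP] := (@nbhs_norm0P _ R^o _).1 (filterI fg psi_inv_near0).
near=> v.
have v2 : `|v| < 1 / 2 by near: v; exact: (@nbhs0_lt _ R^o).
have ve : `|v| < e / 2 by near: v; apply: (@nbhs0_lt _ R^o); rewrite divr_gt0.
have d0 : 1 / 2 < 1 - v by move: v2; rewrite ltr_norml => /andP[]; lra.
have dn0 : 1 - v != 0 by rewrite gt_eqF//; lra.
have we : `|v / (1 - v)| < e.
  rewrite normrM normfV ltr_pdivrMr ?normr_gt0//.
  rewrite (@gtr0_norm _ (1 - v)); last by lra.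
  by nra.
have [] := eP _ we.
have -> : 1 + v / (1 - v) = (1 - v)^-1 by field.
rewrite invrK => + wE; rewrite wE.
by rewrite divfK.
Unshelve. all: by end_near. Qed.

Context (mu01 : mu `[0, 1]%classic = 1%E).

(** Coefficients of [v], [v ^ 2] and [v ^ 3] in [psi_functional_equation]: the
    equation of rank [k] contains [moment mu k] with the factor [expR tau ^ k] and
    otherwise only lower moments. *)
Lemma moments_of_S_transform :
  [/\ moment mu 1 = expR (- tau),
      moment mu 2 = (1 + tau) * expR (- 2 * tau) &
      moment mu 3 = (1 + 2 * tau + 3 / 2 * tau ^+ 2) * expR (- 3 * tau)].
Proof.
pose s : {poly R} := expR tau *: \poly_(i < 4) ((- tau) ^+ i / i`!%:R).
have jG : jet 4 (fun v => v * expR (tau * (1 - v))) ('X * s).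
  have := jetM_horner (expR tau *: 'X) (jet_expR 4 (- tau)).
  rewrite /s -scalerAl scalerAr; apply: eq_jet; near=> v.
  by rewrite hornerZ hornerX mulrBr mulr1 expRD mulNr; ring.
have jL := jet_comp (jet_psi mu01 4) jG isT _.
rewrite hornerM hornerX mul0r in jL.
have jR := eq_jet psi_functional_equation (jL erefl).
have coefE := jet_uniq jR (jet_div1B 4).
set p := \poly_(i < 4) _ in coefE.
have pE : p \Po ('X * s) = moment mu 1 *: ('X^1 * s)
    + moment mu 2 *: ('X^2 * (s * s)) + moment mu 3 *: ('X^3 * (s * s * s)).
  rewrite /p poly_def !big_ord_recr big_ord0 /= !add0r scale0r add0r.
  rewrite !comp_polyD !comp_polyZ !comp_Xn_poly -!mul_polyC; ring.
have s0 : s`_0 = expR tau by rewrite coefZ coef_poly /= divr1 mulr1.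
have s1 : s`_1 = - tau * expR tau.
  by rewrite coefZ coef_poly /= divr1 expr1 mulrC.
have s2 : s`_2 = tau ^+ 2 / 2 * expR tau.
  by rewrite coefZ coef_poly /= sqrrN mulrC.
have ss0 : (s * s)`_0 = expR tau ^+ 2 by rewrite coefM big_ord1 /= s0.
have ss1 : (s * s)`_1 = - 2 * tau * expR tau ^+ 2.
  by rewrite coefM !big_ord_recl big_ord0 /= s0 s1; ring.
have sss0 : (s * s * s)`_0 = expR tau ^+ 3.
  by rewrite coefM big_ord1 /= ss0 s0 -exprSr.
have e0 : expR tau != 0 by rewrite expR_eq0.
have coef1 i : (i.+1 < 4)%N -> (p \Po ('X * s))`_i.+1 = 1.
  by move=> i3; rewrite coefE// coefXM coef_poly /= ltnW.
have E1 := coef1 0%N isT; have E2 := coef1 1%N isT; have E3 := coef1 2%N isT.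
rewrite pE !coefD !coefZ !coefXnM /= in E1 E2 E3.
rewrite !(s0, s1, s2, ss0, ss1, sss0, mulr0, addr0) /= in E1 E2 E3.
have e2 : expR (- 2 * tau) * expR tau ^+ 2 = 1.
  by rewrite mulNr expRN expRM_natl mulVf// expf_neq0.
have e3 : expR (- 3 * tau) * expR tau ^+ 3 = 1.
  by rewrite mulNr expRN expRM_natl mulVf// expf_neq0.
have m1 : moment mu 1 = expR (- tau).
  by rewrite expRN; apply: (mulIf e0); rewrite E1 mulVf.
have m2 : moment mu 2 = (1 + tau) * expR (- 2 * tau).
  apply: (mulIf (expf_neq0 2 e0)); rewrite -mulrA e2 mulr1.
  have -> : moment mu 2 * expR tau ^+ 2 = 1 + tau * (moment mu 1 * expR tau).
    by rewrite -E2; ring.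
  by rewrite E1 mulr1.
split=> //.
apply: (mulIf (expf_neq0 3 e0)); rewrite -[RHS]mulrA e3 mulr1.
have -> : moment mu 3 * expR tau ^+ 3 =
    1 + 2 * tau * (moment mu 2 * expR tau ^+ 2)
    - tau ^+ 2 / 2 * (moment mu 1 * expR tau).
  by rewrite -[X in X + 2 * tau * _]E3; field.
by rewrite E1 m2 -(mulrA (1 + tau)) e2; field.
Unshelve. all: by end_near. Qed.
End MomentsFromSTransform.

Theorem proposition13 (R : realType) (tau : R)
  (mu : probability (measurableTypeR R) R)
  (tau_ge0 : 0 <= tau)
  (mu_supp : mu `[0, 1]%classic = 1%E)
  (mu_S : \forall z \near (0 : R)^', S_transform mu z = expR (tau / (1 + z))) :
  [/\ ct_cumulant mu 1 = expR (- tau),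
      ct_cumulant mu 2 = (expR tau - 1 - tau) * expR (- 2 * tau) &
      ct_cumulant mu 3 = (expR (2 * tau) - 3 * (1 + tau) * expR tau
                          + 2 + 4 * tau + 3 * tau ^+ 2) * expR (- 3 * tau)].
Proof.
have [-> -> ->] := ct_cumulant_moments mu_supp.
have [-> -> ->] := moments_of_S_transform mu_S mu_supp.
have e0 : expR tau != 0 by rewrite expR_eq0.
rewrite !mulNr !expRN !expRM_natl; split=> //; field; exact: e0.
Qed.
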